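(* Let $\pi:(X,T)\to (Y,S)$ be a factor map between dynamical systems. Then $$\mathrm{mdim}(\pi,T)=\sup_{y\in Y}\overline{\mathrm{mdim}}\left(\pi^{-1}(y),T\right)=\sup_{y\in Y}\underline{\mathrm{mdim}}\left(\pi^{-1}(y),T\right).$$
   Context: ''Simplicial complex'' always means a finite simplicial complex (identified with its geometric realization). For a metric space $(X,d)$, a topological space $Y$ and $\varepsilon>0$, a continuous map $f:X\to Y$ is an $\varepsilon$-embedding if $\mathrm{Diam}\, f^{-1}(y)<\varepsilon$ for all $y\in Y$. The $\varepsilon$-width dimension $\mathrm{Widim}_\varepsilon(X,d)$ is the minimum integer $n\ge 0$ such that there exist an $n$-dimensional simplicial complex $P$ and an $\varepsilon$-embedding $f:X\to P$. Subsets of metric spaces carry the restricted metric. A dynamical system $(X,T)$ is a compact metrizable space $X$ with a homeomorphism $T:X\to X$. Given a metric $d$ on $X$ compatible with the topology, for each natural number $N$ set $d_N(x,y)=\max_{0\le n<N} d(T^nx,T^ny)$. For a (not necessarily invariant) closed subset $A\subset X$, the upper and lower mean dimensions are $$\overline{\mathrm{mdim}}(A,T)=\lim_{\varepsilon\to 0}\left(\limsup_{N\to\infty}\frac{\mathrm{Widim}_\varepsilon(A,d_N)}{N}\right),\qquad \underline{\mathrm{mdim}}(A,T)=\lim_{\varepsilon\to 0}\left(\liminf_{N\to\infty}\frac{\mathrm{Widim}_\varepsilon(A,d_N)}{N}\right).$$ These are independent of the choice of $d$. A factor map $\pi:(X,T)\to(Y,S)$ between dynamical systems is a continuous surjection $\pi:X\to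 Y$ with $\pi\circ T=S\circ\pi$. Its relative mean dimension is $$\mathrm{mdim}(\pi,T)=\lim_{\varepsilon\to 0}\left(\lim_{N\to\infty}\frac{\sup_{y\in Y}\mathrm{Widim}_\varepsilon(\pi^{-1}(y),d_N)}{N}\right)$$ (the limits exist by subadditivity in $N$ and monotonicity in $\varepsilon$). All these quantities take values in $[0,\infty]$. *)

(* Defs.v *)
From HB Require Import structures.
From mathcomp Require Import all_boot all_order all_algebra.
From mathcomp Require Import all_classical all_reals all_analysis.

Set Implicit Arguments.
Unset Strict Implicit.
Unset Printing Implicit Defensive.

Import Order.TTheory GRing.Theory Num.Theory.
Import numFieldTopology.Exports numFieldNormedType.Exports.

Local Open Scope classical_set_scope.
Local Open Scope ring_scope.

(* Supremum in [0, +oo]: unlike ereal_sup, it is 0 (not -oo) on set0. *)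
Definition nneg_sup (R : realType) (S : set (\bar R)) : \bar R :=
  ereal_sup (0%E |` S).

(* Finite abstract simplicial complexes with vertices among 'I_k; an element of
   'I_k need not be a vertex. *)
Record simplicial_complex (k : nat) := SimplicialComplex {
  simplices : {set {set 'I_k}};
  simplices_neq0 : finset.set0 \notin simplices;
  simplices_closed : forall s t : {set 'I_k},
    s \in simplices -> t \subset s -> t != finset.set0 -> t \in simplices
}.

(* A simplex with m vertices has dimension m - 1, so the empty complex (of
   dimension -1) has no dimension in the sense of this predicate. *)
Definition has_dimension (k : nat) (K : simplicial_complex k) (n : nat) : Prop :=
  (\max_(s in simplices K) #|s| = n.+1)%N.

(* Geometric realization, by barycentric coordinates: the support of the point
   p is required to be a simplex. *)
Definition realization (R : realType) (k : nat) (K : simplicial_complex k) :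
    set 'rV[R]_k :=
  [set p : 'rV[R]_k | [/\ forall i, 0 <= p ord0 i, \sum_i p ord0 i = 1 &
    [set i | p ord0 i != 0]%SET \in simplices K]].

Definition diam (R : realType) (X : Type) (d : X -> X -> R) (A : set X) :
    \bar R :=
  nneg_sup [set (d z.1 z.2)%:E | z in A `*` A].

(* Here A carries the subspace topology of X and the distance d. For a metric d
   inducing the topology of X, this is the notion of eps-embedding of the metric
   space (A, d). *)
Definition eps_embedding (R : realType) (X : topologicalType)
    (d : X -> X -> R) (A : set X) (eps : R)
    (k : nat) (K : simplicial_complex k) (f : X -> 'rV[R]_k) : Prop :=
  [/\ {within A, continuous f},
      f @` A `<=` realization K &
      forall p, realization K p ->
        (diam d (A `&` f @^-1` [set p]) < eps%:E)%E].

(* The infimum is a minimum whenever the set is nonempty; it is +oo otherwise,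
   which does not happen for compact A and eps > 0. *)
Definition Widim (R : realType) (X : topologicalType)
    (d : X -> X -> R) (A : set X) (eps : R) : \bar R :=
  ereal_inf [set (n%:R)%:E | n in [set n : nat |
    exists (k : nat) (K : simplicial_complex k) (f : X -> 'rV[R]_k),
      has_dimension K n /\ eps_embedding d A eps K f]].

Definition homeomorphism (X Y : topologicalType) (f : X -> Y) : Prop :=
  continuous f /\
  exists g : Y -> X, [/\ cancel f g, cancel g f & continuous g].

Definition dynamical_system (X : topologicalType) (T : X -> X) : Prop :=
  compact [set: X] /\ homeomorphism T.

Definition factor_map (X Y : topologicalType) (T : X -> X) (S : Y -> Y)
    (pi : X -> Y) : Prop :=
  [/\ continuous pi, range pi = [set: Y] & pi \o T = S \o pi].

(* For continuous T and N > 0 this metric induces the topology of X; for N = 0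
   it is constantly 0, which is irrelevant to the limits in N below. *)
Definition mdistN (R : realType) (X : metricType R) (T : X -> X) (N : nat)
    (x y : X) : R :=
  \big[Num.max/0]_(n < N) mdist (iter n T x) (iter n T y).

Definition upper_mdim (R : realType) (X : metricType R) (T : X -> X)
    (A : set X) : \bar R :=
  lim (limn_esup (fun N : nat =>
         (Widim (mdistN T N) A eps * (N%:R^-1)%:E)%E) @[eps --> (0 : R)^'+]).

Definition lower_mdim (R : realType) (X : metricType R) (T : X -> X)
    (A : set X) : \bar R :=
  lim (limn_einf (fun N : nat =>
         (Widim (mdistN T N) A eps * (N%:R^-1)%:E)%E) @[eps --> (0 : R)^'+]).

Definition relative_mdim (R : realType) (X : metricType R) (Y : Type)
    (T : X -> X) (pi : X -> Y) : \bar R :=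
  lim (limn (fun N : nat =>
         (nneg_sup [set Widim (mdistN T N) (pi @^-1` [set y]) eps
                     | y in [set: Y]] * (N%:R^-1)%:E)%E)
       @[eps --> (0 : R)^'+]).

(* Main.v *)
(* The two inequalities lower <= upper <= relative hold fiber by fiber, so the point
   is relative <= lower, for a fixed scale eps. If the liminf of the normalized
   widths of every fiber is below c, then each y has a block length N with
   Widim(pi^-1(y), d_N) <= c N. An eps-embedding of a compact fiber extends to the
   nearby fibers (Tietze, followed by a retraction of a neighbourhood of the skeleton
   onto it), so N also works near y, and by compactness of Y the block lengths are
   bounded by some M. Cutting the orbit of y into such blocks and using
   Widim(A, d_(N + N')) <= Widim(A, d_N) + Widim(T^N A, d_N') gives
   Widim(pi^-1(y), d_N) <= c (N + M) for all y and N at once. The subadditivity needs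
   a triangulation of a product of simplices, here the staircase one. The same bound
   shows that the limit over N exists. *)
Require Import Defs.
From mathcomp Require Import all_boot all_order all_algebra.
From mathcomp Require Import all_classical all_reals all_analysis.
From mathcomp Require Import ring lra.

Set Implicit Arguments.
Unset Strict Implicit.
Unset Printing Implicit Defensive.

Import Order.TTheory GRing.Theory Num.Theory.
Import numFieldTopology.Exports numFieldNormedType.Exports.

Local Open Scope classical_set_scope.
Local Open Scope ring_scope.

(** * Staircase triangulation of a product of two simplices *)

Section Staircase.
Context {R : realType}.
Implicit Types k l : nat.

Definition cumul k (p : 'I_k -> R) (m : nat) : R := \sum_(i < k | (i < m)%N) p i.

Lemma cumul0 k (p : 'I_k -> R) : cumul p 0 = 0.
Proof. by rewrite /cumul big_pred0. Qed.

Lemma cumul_full k (p : 'I_k -> R) : cumul p k = \sum_i p i.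
Proof. by apply: eq_bigl => i; rewrite ltn_ord. Qed.

Lemma cumulS k (p : 'I_k -> R) (i : 'I_k) : cumul p i.+1 = cumul p i + p i.
Proof.
rewrite /cumul (bigD1 i) //= addrC; congr (_ + _); apply: eq_bigl => j.
by rewrite ltnS ltn_neqAle andbC.
Qed.

Lemma cumul_le k (p : 'I_k -> R) m m' :
  (forall i, 0 <= p i) -> (m <= m')%N -> cumul p m <= cumul p m'.
Proof.
move=> p0 mm'; rewrite /cumul [leLHS]big_mkcond [leRHS]big_mkcond /=.
apply: ler_sum => i _; case: ifPn => [im|_]; first by rewrite (leq_trans im).
by case: ifP.
Qed.

(* Cutting [0, 1] at the partial sums of p and at those of q, the cell (i, j) is
   the length of the common part of the i-th p-interval and the j-th q-interval. *)
Definition staircase k l (p : 'I_k -> R) (q : 'I_l -> R) (ij : 'I_k * 'I_l) : R :=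
  let m a b := Num.min (cumul p a) (cumul q b) in
  m ij.1.+1 ij.2.+1 - m ij.1 ij.2.+1 - m ij.1.+1 ij.2 + m ij.1 ij.2.

Lemma staircaseC k l (p : 'I_k -> R) (q : 'I_l -> R) i j :
  staircase p q (i, j) = staircase q p (j, i).
Proof. by rewrite /staircase /= ![Num.min (cumul q _) _]minC; ring. Qed.

(** The sum over j telescopes. At j = 0 both minima vanish, and at j = l the partial sums of q have
    reached a total that dominates those of p, so what remains is [cumul p i.+1 - cumul p i]. *)
Lemma staircase_row k l (p : 'I_k -> R) (q : 'I_l -> R) i :
  (forall i, 0 <= p i) -> \sum_i p i <= \sum_j q j ->
  \sum_j staircase p q (i, j) = p i.
Proof.
move=> p0 pq.
pose G m := Num.min (cumul p i.+1) (cumul q m) - Num.min (cumul p i) (cumul q m).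
have -> : \sum_j staircase p q (i, j) = \sum_(0 <= j < l) (G j.+1 - G j).
  by rewrite big_mkord; apply: eq_bigr => j _; rewrite /staircase /G /=; ring.
rewrite telescope_sumr // /G cumul0 cumul_full.
have c0 m : 0 <= cumul p m by apply: sumr_ge0 => *; exact: p0.
have cq m : (m <= k)%N -> cumul p m <= \sum_j q j.
  by move=> mk; apply: le_trans pq; rewrite -cumul_full; exact: cumul_le.
rewrite !(min_idPl (cq _ _)) ?(ltnW (ltn_ord i))//.
by rewrite !(min_idPr (c0 _)) cumulS; ring.
Qed.

Lemma staircase_ge0 k l (p : 'I_k -> R) (q : 'I_l -> R) ij :
  (forall i, 0 <= p i) -> (forall j, 0 <= q j) -> 0 <= staircase p q ij.
Proof.
move=> p0 q0; rewrite /staircase !cumulS.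
have := p0 ij.1; have := q0 ij.2.
set a := cumul p _; set b := cumul q _; set u := p _; set v := q _.
move=> *; rewrite /Num.min; do ![case: ltP => ?]; lra.
Qed.

Lemma staircase_neq0 k l (p : 'I_k -> R) (q : 'I_l -> R) ij :
  (forall i, 0 <= p i) -> (forall j, 0 <= q j) -> staircase p q ij != 0 ->
  [/\ p ij.1 != 0, q ij.2 != 0, cumul p ij.1 < cumul q ij.2.+1 &
      cumul q ij.2 < cumul p ij.1.+1].
Proof.
move=> p0 q0; rewrite /staircase !cumulS.
have := p0 ij.1; have := q0 ij.2.
set a := cumul p _; set b := cumul q _; set u := p _; set v := q _.
move=> v0 u0 w0; suff [? ? ? ?] : [/\ 0 < u, 0 < v, a < b + v & b < a + u].
  by split => //; rewrite gt_eqF.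
by split; rewrite ltNge; apply/negP => ?; move: w0 => /eqP; apply;
  rewrite /Num.min; do ![case: ltP => ?]; lra.
Qed.

End Staircase.

(** Totality of the product order on c: pairs with equal first coordinates are comparable in any
    case. *)
Definition is_chain k l (c : {set 'I_k * 'I_l}) :=
  forall x y, x \in c -> y \in c -> (x.1 < y.1)%N -> (x.2 <= y.2)%N.

(** The rank in s of the first coordinate plus the rank in t of the second grows strictly along a
    chain and lies between 0 and m + n. *)
Lemma card_chain k l (c : {set 'I_k * 'I_l}) (s : {set 'I_k}) (t : {set 'I_l}) m n :
  is_chain c -> (forall x, x \in c -> x.1 \in s /\ x.2 \in t) ->
  (#|s| <= m.+1)%N -> (#|t| <= n.+1)%N -> (#|c| <= (m + n).+1)%N.
Proof.
move=> cc cst sm tn.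
pose rk (N : nat) (u : {set 'I_N}) (i : 'I_N) := #|[set j in u | (j < i)%N]%SET|.
have rk_le N (u : {set 'I_N}) (i j : 'I_N) : (i <= j)%N -> (rk N u i <= rk N u j)%N.
  move=> ij; apply/subset_leq_card/fintype.subsetP => a.
  by rewrite !inE => /andP[-> /leq_trans]; apply.
have rk_lt N (u : {set 'I_N}) (i j : 'I_N) :
    i \in u -> (i < j)%N -> (rk N u i < rk N u j)%N.
  move=> iu ij; apply: proper_card; apply/fintype.properP; split.
    by apply/fintype.subsetP => a; rewrite !inE => /andP[-> /ltn_trans]; apply.
  by exists i; rewrite !inE ?iu ?ij ?ltnn.
have rk_card N (u : {set 'I_N}) M (i : 'I_N) :
    i \in u -> (#|u| <= M.+1)%N -> (rk N u i <= M)%N.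
  move=> iu uM; rewrite -ltnS; apply: leq_trans uM; apply: proper_card.
  apply/fintype.properP; split.
    by apply/fintype.subsetP => a; rewrite !inE => /andP[].
  by exists i; rewrite // !inE ltnn andbF.
pose h (x : 'I_k * 'I_l) := (rk k s x.1 + rk l t x.2)%N.
have h_lt x y : x \in c -> y \in c -> (x.1 < y.1)%N -> (h x < h y)%N.
  move=> xc yc xy; rewrite /h -addSn leq_add ?rk_le ?(cc x y)//.
  by apply: rk_lt => //; case: (cst _ xc).
have h_lt2 x y : x \in c -> y \in c -> x.1 = y.1 -> (x.2 < y.2)%N -> (h x < h y)%N.
  move=> xc _ xy1 xy2; rewrite /h xy1 ltn_add2l; apply: rk_lt => //.
  by case: (cst _ xc).
have h_inj : {in c &, injective (fun x => inord (h x) : 'I_(m + n).+1)}.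
  move=> x y xc yc /(congr1 val) /=.
  have hm z : z \in c -> (h z < (m + n).+1)%N.
    by move=> /cst[zs zt]; rewrite ltnS leq_add ?rk_card.
  rewrite !inordK ?hm// => hxy.
  have [xy1|xy1|/val_inj xy1] := ltngtP x.1 y.1.
  - by have := h_lt x y xc yc xy1; rewrite hxy ltnn.
  - by have := h_lt y x yc xc xy1; rewrite hxy ltnn.
  have [xy2|xy2|/val_inj xy2] := ltngtP x.2 y.2.
  - by have := h_lt2 x y xc yc xy1 xy2; rewrite hxy ltnn.
  - by have := h_lt2 y x yc xc (esym xy1) xy2; rewrite hxy ltnn.
  by move: x y xy1 xy2 {xc yc hxy} => [? ?] [? ?] /= -> ->.
by rewrite -(card_in_imset h_inj) (leq_trans (max_card _))// card_ord.
Qed.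

(** If x.1 < y.1, the p-interval of x ends before that of y begins. Since each p-interval meets its
    q-interval, the q-interval of x begins before that of y ends. *)
Lemma staircase_chain (R : realType) k l (p : 'I_k -> R) (q : 'I_l -> R) :
  (forall i, 0 <= p i) -> (forall j, 0 <= q j) ->
  is_chain [set ij | staircase p q ij != 0]%SET.
Proof.
move=> p0 q0 x y; rewrite !inE.
move=> /(staircase_neq0 p0 q0)[_ _ _ xy] /(staircase_neq0 p0 q0)[_ _ yx _] x1y1.
rewrite -ltnS ltnNge; apply/negP => /(cumul_le q0).
by rewrite leNgt (lt_trans xy)// (le_lt_trans _ yx)// cumul_le.
Qed.

Lemma min_pair_continuous (R : realType) :
  continuous (fun u : R * R => Num.min u.1 u.2).
Proof. by move=> u; apply: continuous_min; [exact: cvg_fst|exact: cvg_snd]. Qed.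

Lemma max_pair_continuous (R : realType) :
  continuous (fun u : R * R => Num.max u.1 u.2).
Proof. by move=> u; apply: continuous_max; [exact: cvg_fst|exact: cvg_snd]. Qed.

Lemma cvg_row (R : realType) (X : Type) (F : set_system X) (k : nat)
    (f : 'I_k -> X -> R) (v : 'I_k -> R) : Filter F ->
  (forall i, f i x @[x --> F] --> v i) ->
  (\row_i f i x) @[x --> F] --> (\row_i v i : 'rV[R]_k).
Proof.
move=> FF fv B [P vP PB]; apply: (@filterS _ F _ [set x | forall i, P ord0 i (f i x)]).
  move=> x Px; apply: PB => i j; rewrite mxE (ord1 i); exact: Px.
apply: filter_forall => i; apply: (fv i).
by have := vP ord0 i; rewrite mxE.
Qed.

(** * Width in terms of maps to skeleta, and its subadditivity *)

Section NarrowMaps.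
Context {R : realType} {X : topologicalType}.
Implicit Types (d : X -> X -> R) (A : set X) (eps : R).

(* Only the dimension of the target complex matters, so the target may be taken to
   be the n-skeleton of the simplex with vertex set I: f consists of barycentric
   coordinates, at most n+1 of which are nonzero. *)
Definition narrow_map (I : finType) d A eps (n : nat) (f : I -> X -> R) :=
  [/\ forall i, {within A, continuous (f i)},
      forall x, A x -> [/\ forall i, 0 <= f i x, \sum_i f i x = 1 &
        (#|[set i | f i x != 0%R]%SET| <= n.+1)%N] &
      forall x, A x -> exists2 e, e < eps & forall x1 x2, A x1 -> A x2 ->
        f^~ x1 =1 f^~ x -> f^~ x2 =1 f^~ x -> d x1 x2 <= e].

Definition has_narrow_map d A eps n :=
  exists (k : nat) (f : 'I_k -> X -> R), narrow_map d A eps n f.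

(** Staircase weights are indexed by pairs of vertices, which have to be renumbered. *)
Lemma narrow_map_finType (I : finType) d A eps n (f : I -> X -> R) :
  narrow_map d A eps n f -> has_narrow_map d A eps n.
Proof.
move=> [fc fs fd]; exists #|I|, (f \o enum_val); split => [i|x Ax|x Ax].
- exact: fc.
- have [f0 f1 fn] := fs x Ax; split => [i||]; first exact: f0.
    by rewrite -f1 (reindex _ (onW_bij _ (enum_val_bij I))).
  apply: leq_trans fn; rewrite -(card_imset _ (@enum_val_inj I predT)).
  apply/subset_leq_card/fintype.subsetP => _ /imsetP[j + ->].
  by rewrite !inE.
- have [e e_eps fe] := fd x Ax; exists e => // x1 x2 Ax1 Ax2 e1 e2.
  by apply: fe => // i; [have := e1 (enum_rank i) | have := e2 (enum_rank i)];
    rewrite /= enum_rankK.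
Qed.

Definition skeleton_simplices k n : {set {set 'I_k}} :=
  [set s : {set 'I_k} | (0 < #|s| <= n.+1)%N]%SET.

Lemma skeleton_simplices_neq0 k n : finset.set0 \notin skeleton_simplices k n.
Proof. by rewrite inE cards0. Qed.

Lemma skeleton_simplices_closed k n (s t : {set 'I_k}) :
  s \in skeleton_simplices k n -> t \subset s -> t != finset.set0 ->
  t \in skeleton_simplices k n.
Proof.
rewrite !inE => /andP[_ sn] /subset_leq_card ts t0.
by rewrite card_gt0 t0 (leq_trans ts).
Qed.

Definition skeleton k n : simplicial_complex k :=
  SimplicialComplex (skeleton_simplices_neq0 k n) (@skeleton_simplices_closed k n).

Lemma Widim_le d A eps n : A !=set0 -> 0 < eps -> has_narrow_map d A eps n ->
  (Widim d A eps <= n%:R%:E)%E.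
Proof.
move=> [a Aa] eps0 [k [f [fc fs fd]]].
have f_real x : A x -> realization (skeleton k n) (\row_i f i x).
  move=> /fs[f0 f1 fn]; split => [i||]; first by rewrite mxE.
    by rewrite -f1; apply: eq_bigr => i _; rewrite mxE.
  have -> : [set i | (\row_i f i x) ord0 i != 0]%SET = [set i | f i x != 0]%SET.
    by apply/setP => i; rewrite !inE mxE.
  rewrite inE fn andbT card_gt0; apply/eqP => /setP f_0.
  have := f1; rewrite big1 => [/eqP|i _]; first by rewrite eq_sym oner_eq0.
  by have := f_0 i; rewrite !inE => /negbFE/eqP.
(* For k <= n the skeleton has dimension less than n, so the bound goes through its actual dimension
   m - 1. The point a guarantees that there is a simplex. *)
pose m := (\max_(s in simplices (skeleton k n)) #|s|)%N.
have m0 : (0 < m)%N.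
  have [_ _ sS] := f_real _ Aa.
  apply: (leq_trans _ (leq_bigmax_cond _ sS)).
  by move: sS; rewrite inE => /andP[].
have mn : (m <= n.+1)%N by apply/bigmax_leqP => s; rewrite inE => /andP[].
apply: (@le_trans _ _ m.-1%:R%:E); last first.
  by rewrite lee_fin ler_nat -ltnS prednK.
apply: ereal_inf_lbound; exists m.-1 => //=.
exists k, (skeleton k n), (fun x => \row_i f i x); split.
  by rewrite /has_dimension prednK.
split.
- apply/subspace_continuousP => x Ax; apply: cvg_row => i.
  by have /subspace_continuousP := fc i; apply.
- by move=> _ [x Ax <-]; exact: f_real.
- move=> p _.
  have [[x [Ax xp]]|np] := pselect (exists x, A x /\ \row_i f i x = p); last first.
    rewrite /diam /nneg_sup.
    apply: (@le_lt_trans _ _ 0%E); last by rewrite lte_fin.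
    apply: ge_ereal_sup => _ [->//|[[x y] [[Ax xp] _] <-]].
    by exfalso; apply: np; exists x.
  have [e e_eps fe] := fd x Ax.
  (* [d] is an arbitrary function here, so e may be negative, whereas [diam] is at least 0. *)
  apply: (@le_lt_trans _ _ (Num.max 0 e)%:E); last by rewrite lte_fin gt_max eps0.
  apply: ge_ereal_sup => _ [->|[[x1 x2] /= [[Ax1 x1p] [Ax2 x2p]] <-]].
    by rewrite lee_fin le_max lexx.
  rewrite lee_fin le_max; apply/orP; right; apply: fe => // i.
    by move: x1p => /=; rewrite -xp => /rowP/(_ i); rewrite !mxE.
  by move: x2p => /=; rewrite -xp => /rowP/(_ i); rewrite !mxE.
Qed.

(** A strict bound on the infimum yields an actual embedding, whose barycentric coordinates form the
    narrow map. *)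
Lemma Widim_lt d A eps r : (Widim d A eps < r)%E ->
  exists2 n, has_narrow_map d A eps n & (n%:R%:E < r)%E.
Proof.
move=> /ereal_inf_lt[_ [n [k [K [f [Kn [fc fK fd]]]]] <-] nr].
exists n => //; exists k, (fun i x => f x ord0 i); split.
- move=> i; apply/subspace_continuousP => x Ax.
  apply: (cvg_comp f (fun M : 'rV[R]_k => M ord0 i)); last exact: coord_continuous.
  by move/subspace_continuousP : fc; apply.
- move=> x Ax; have [|f0 f1 fs] := fK (f x); first by exists x.
  split=> //; rewrite -[n.+1]Kn.
  exact: (@leq_bigmax_cond _ (mem (simplices K)) (fun s => #|s|)).
- move=> x Ax; have /fd : realization K (f x) by apply: fK; exists x.
  rewrite /diam; set D := nneg_sup _ => Deps.
  have D0 : (0 <= D)%E by apply: ereal_sup_ubound; left.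
  have Dfin : D \is a fin_num by rewrite ge0_fin_numE// (lt_trans Deps)// ltry.
  exists (fine D); first by rewrite -lte_fin fineK.
  move=> x1 x2 Ax1 Ax2 e1 e2; rewrite -lee_fin fineK//.
  apply: ereal_sup_ubound; right; exists (x1, x2) => //=.
  by split; split => //=; apply/rowP.
Qed.

Lemma narrow_map_le d d' A eps eps' n : (forall x y, d' x y <= d x y) ->
  eps <= eps' -> has_narrow_map d A eps n -> has_narrow_map d' A eps' n.
Proof.
move=> dd' ee [k [f [fc fs fd]]]; exists k, f; split=> // x /fd[e e_eps fe].
exists e; first exact: lt_le_trans ee.
by move=> x1 x2 *; apply: le_trans (dd' _ _) _; exact: fe.
Qed.

Lemma within_continuous_comp (Z : topologicalType) A (B : set Z) (h : X -> Z)
    (g : Z -> R) : continuous h -> h @` A `<=` B ->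
  {within B, continuous g} -> {within A, continuous (g \o h)}.
Proof.
move=> hc hAB /subspace_continuousP gc; apply/subspace_continuousP => x Ax.
apply: (@cvg_comp _ _ _ h g _ (within B (nbhs (h x)))).
  move=> U /= BU; have := hc x _ BU; rewrite /within /= !nbhs_simpl /=.
  by apply: filterS => z Uz Az; apply: Uz; apply: hAB; exists z.
by apply: gc; apply: hAB; exists x.
Qed.

End NarrowMaps.

(** The staircase weights of f x and g (h x) are coordinates on their product. Their support is a
    chain, so dimensions add. Their row and column sums give back f x and g (h x), so points with
    equal weights are close for both distances. *)
Lemma narrow_map_prod (R : realType) (X Z : topologicalType) (d d1 : X -> X -> R)
    (d2 : Z -> Z -> R) (A : set X) (B : set Z) (h : X -> Z) (eps : R) n m :
  continuous h -> h @` A `<=` B ->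
  (forall x y, d x y <= Num.max (d1 x y) (d2 (h x) (h y))) ->
  has_narrow_map d1 A eps n -> 
  has_narrow_map d2 B eps m ->
  has_narrow_map d A eps (n + m).
Proof.
move=> hc hAB dd [k [f [fc fs fd]]] [l [g [gc gs gd]]].
have hB x : A x -> B (h x) by move=> Ax; apply: hAB; exists x.
pose w (ij : 'I_k * 'I_l) x := staircase (f^~ x) (fun j => g j (h x)) ij.
have wl x i : A x -> \sum_j w (i, j) x = f i x.
  move=> Ax; have [f0 f1 _] := fs x Ax; have [g0 g1 _] := gs _ (hB x Ax).
  by rewrite (staircase_row i f0)// f1 g1.
have wr x j : A x -> \sum_i w (i, j) x = g j (h x).
  move=> Ax; have [f0 f1 _] := fs x Ax; have [g0 g1 _] := gs _ (hB x Ax).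
  under eq_bigr do rewrite /w staircaseC.
  by rewrite (staircase_row j g0)// f1 g1.
apply: (narrow_map_finType (f := w)); split.
- have cumul_cvg N (u : 'I_N -> X -> R) a x :
      (forall i, u i z @[z --> within A (nbhs x)] --> u i x) ->
      cumul (u^~ z) a @[z --> within A (nbhs x)] --> cumul (u^~ x) a.
    move=> uc; rewrite /cumul; apply: cvg_big => // z; exact: add_continuous.
  move=> ij; apply/subspace_continuousP => x Ax.
  have Pc a : cumul (f^~ z) a @[z --> within A (nbhs x)] --> cumul (f^~ x) a.
    by apply: cumul_cvg => i; have /subspace_continuousP := fc i; apply.
  have Qc b : cumul (fun j => g j (h z)) b @[z --> within A (nbhs x)] -->
              cumul (fun j => g j (h x)) b.
    apply: (cumul_cvg _ (fun j => g j \o h)) => j.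
    have /subspace_continuousP := within_continuous_comp hc hAB (gc j); exact.
  rewrite /w /staircase; apply: cvgD; first apply: cvgB; first apply: cvgB;
    exact: (cvg_comp2 (Pc _) (Qc _) (@min_pair_continuous R (_, _))).
- move=> x Ax; have [f0 f1 fn] := fs x Ax; have [g0 g1 gm] := gs _ (hB x Ax).
  split; first by move=> ij; exact: staircase_ge0.
    rewrite -f1; under [RHS]eq_bigr do rewrite -(wl x _ Ax).
    by rewrite pair_bigA /=; apply: eq_bigr => -[].
  apply: card_chain fn gm; first exact: staircase_chain.
  by move=> ij; rewrite !inE => /(staircase_neq0 f0 g0)[].
- move=> x Ax; have [e1 e1eps fe] := fd x Ax; have [e2 e2eps ge] := gd _ (hB x Ax).
  exists (Num.max e1 e2); first by rewrite gt_max e1eps.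
  move=> x1 x2 Ax1 Ax2 w1 w2; apply: (le_trans (dd _ _)).
  have ff y : A y -> w^~ y =1 w^~ x -> f^~ y =1 f^~ x.
    move=> Ay wy i; rewrite -(wl x i Ax) -(wl y i Ay).
    by apply: eq_bigr => j _; exact: wy.
  have gg y : A y -> w^~ y =1 w^~ x -> g^~ (h y) =1 g^~ (h x).
    move=> Ay wy i; rewrite -(wr x i Ax) -(wr y i Ay).
    by apply: eq_bigr => j _; exact: wy.
  rewrite ge_max !le_max; apply/andP; split.
    by rewrite fe//; exact: ff.
  by rewrite ge ?orbT//; [exact: hB|exact: hB|exact: gg|exact: gg].
Qed.

(** * Retraction of a neighbourhood of the n-skeleton onto it *)

Section Retraction.
Context {R : realType} {k : nat}.
Implicit Types (n : nat) (v : 'I_k -> R).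

(* For v with values in [0, 1] this is the (n+2)-nd largest coordinate. *)
Definition level n v : R :=
  \big[Num.max/0]_(s : {set 'I_k} | #|s| == n.+2) \big[Num.min/1]_(i in s) v i.

Definition cutoff n v i := Num.max 0 (v i - level n v).

(** Where no coordinate exceeds the level, division by 0 gives the zero vector; the map is
    meaningful only where the sum is positive. *)
Definition retract n v i := cutoff n v i / \sum_j cutoff n v j.

Lemma cutoff_ge0 n v i : 0 <= cutoff n v i.
Proof. by rewrite le_max lexx. Qed.

(** If n + 2 coordinates exceeded the level, so would their minimum, which is one of the values
    whose maximum is the level. *)
Lemma card_cutoff n v : (forall i, v i <= 1) ->
  (#|[set i | cutoff n v i != 0%R]%SET| <= n.+1)%N.
Proof.
move=> v1; rewrite leqNgt; apply/negP => /card_geqP[r [ru rn rs]].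
pose s := [set i in r]%SET.
have sn : #|s| = n.+2 by rewrite cardsE (card_uniqP ru).
have ss : s \subset [set i | cutoff n v i != 0%R]%SET.
  by apply/fintype.subsetP => i; rewrite /s inE => /rs.
have lev i : i \in s -> level n v < v i.
  move=> /(fintype.subsetP ss); rewrite inE; apply: contraNT; rewrite -leNgt => vi.
  by rewrite /cutoff; apply/eqP/max_idPl; rewrite subr_le0.
have [i is_] : exists i, i \in s by apply/card_gt0P; rewrite sn.
suff : level n v < level n v by rewrite ltxx.
apply: (@lt_le_trans _ _ (\big[Num.min/1]_(i in s) v i)).
  (* The default value 1 of the minimum must exceed the level as well; this follows from v i <=
     1. *)
  apply: lt_bigmin; last exact: lev.
  exact: lt_le_trans (lev i is_) (v1 i).
apply: (@le_bigmax_cond _ _ _ 0 s (fun s : {set 'I_k} => #|s| == n.+2)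
  (fun s : {set 'I_k} => \big[Num.min/1]_(i in s) v i)).
exact/eqP.
Qed.

(** Any n + 2 indices include one with a zero coordinate, so every minimum is at most 0. *)
Lemma level_eq0 n v : (forall i, 0 <= v i) ->
  (#|[set i | v i != 0%R]%SET| <= n.+1)%N -> level n v = 0.
Proof.
move=> v0 vn; apply/eqP; rewrite eq_le; apply/andP; split; last first.
  exact: bigmax_ge_id.
apply: bigmax_le => // s /eqP sn.
have [i is_ vi] : exists2 i, i \in s & v i = 0.
  have /fintype.subsetPn[i is_] : ~~ (s \subset [set i | v i != 0%R]%SET).
    by apply/negP => /subset_leq_card; rewrite sn => /leq_trans/(_ vn); rewrite ltnn.
  by rewrite inE negbK => /eqP; exists i.
by rewrite -vi; apply: (@bigmin_le_cond _ _ _ 1 i (fun j => j \in s) v).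
Qed.

Lemma retract_id n v : (forall i, 0 <= v i) -> \sum_i v i = 1 ->
  (#|[set i | v i != 0%R]%SET| <= n.+1)%N -> retract n v =1 v.
Proof.
move=> v0 v1 vn i; have cv j : cutoff n v j = v j.
  by rewrite /cutoff level_eq0// subr0; exact/max_idPr.
by rewrite /retract (eq_bigr _ (fun j _ => cv j)) v1 divr1 cv.
Qed.

Lemma cutoff_cvg (T : Type) (F : set_system T) n (f : 'I_k -> T -> R) v i :
  Filter F -> (forall i, f i x @[x --> F] --> v i) ->
  cutoff n (f^~ x) i @[x --> F] --> cutoff n v i.
Proof.
move=> FF fv.
apply: (cvg_comp2 _ _ (@max_pair_continuous R (_, _))); first exact: cvg_cst.
apply: cvgB; first exact: fv.
apply: cvg_big => [|s _]; first exact: max_pair_continuous.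
by apply: cvg_big => [|j _]; [exact: min_pair_continuous|exact: fv].
Qed.

End Retraction.

(** * Extension of narrow maps from a fiber to nearby fibers *)

Section FiberNeighbourhood.
Context {R : realType} {X Y : topologicalType}.
Hypotheses (cptX : compact [set: X]) (hausX : hausdorff_space X)
  (hausY : hausdorff_space Y).
Variables (pi : X -> Y) (d : X -> X -> R).
Hypotheses (pic : continuous pi) (dc : continuous (fun z : X * X => d z.1 z.2)).

Lemma near_neq (x : X) (y : Y) : pi x != y ->
  \forall x' \near x & u \near y, pi x' != u.
Proof.
move: hausY; rewrite open_hausdorff => /[apply] -[[U V] /= [xU yV] [oU oV UV]].
exists (pi @^-1` U, V) => /=.
  split; last by apply: open_nbhs_nbhs; split => //; exact: set_mem.
  by apply: pic; apply: open_nbhs_nbhs; split => //; exact: set_mem.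
move=> [x' u] /= [x'U uV]; apply/eqP => x'u.
have : (U `&` V) u by split => //; rewrite -x'u.
by move/eqP : UV => ->.
Qed.

(** What the extended map must satisfy is a condition on pairs of points that persists near each
    pair as the base point moves; compactness of X * X then gives one neighbourhood of y for all
    pairs. *)
Lemma near_fiber_narrow_map eps n (y : Y) :
  has_narrow_map d (pi @^-1` [set y]) eps n ->
  \forall u \near y, has_narrow_map d (pi @^-1` [set u]) eps n.
Proof.
set A := pi @^-1` [set y] => -[k [f [fc fs fd]]].
have clA : closed A.
  apply: closed_comp => [x _|]; first exact: pic.
  by apply: accessible_closed_set1; exact: hausdorff_accessible.
(* Tietze extension of each coordinate; the bound 1 is kept for [card_cutoff]. *)
have /choice[g gP] : forall i, exists g : X -> R^o,
    [/\ {in A, f i =1 g}, continuous g & forall x, `|g x| <= 1].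
  move=> i; apply: continuous_bounded_extension => //.
    exact: compact_normal.
  move=> x Ax; have [f0 f1 _] := fs x Ax.
  rewrite ger0_norm// -f1 (bigD1 i)//= lerDl; exact: sumr_ge0.
have gf i x : A x -> g i x = f i x.
  by move=> Ax; have [gA _ _] := gP i; rewrite gA// inE.
have gc i : continuous (g i) by have [] := gP i.
have g1 i x : g i x <= 1.
  by have [_ _ gb] := gP i; apply: le_trans (gb x); exact: ler_norm.
pose F i x := retract n (g^~ x) i.
pose sigma x := \sum_i cutoff n (g^~ x) i.
have FA i x : A x -> F i x = f i x.
  move=> Ax; have [f0 f1 fn] := fs x Ax.
  have gfx : g^~ x = f^~ x by apply/funext => j; exact: gf.
  by rewrite /F gfx retract_id.
have sigmaA x : A x -> 0 < sigma x.
  move=> Ax; have [f0 f1 fn] := fs x Ax.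
  have gfx : g^~ x = f^~ x by apply/funext => j; exact: gf.
  rewrite /sigma gfx.
  under eq_bigr do rewrite /cutoff level_eq0// subr0 (max_idPr (f0 _)).
  by rewrite f1.
have cut_c i : continuous (fun x => cutoff n (g^~ x) i).
  by move=> x; apply: cutoff_cvg => j; exact: gc.
have sigma_c : continuous sigma.
  by move=> x; apply: cvg_big => [|j _]; [exact: add_continuous|exact: cut_c].
have F_c i x : 0 < sigma x -> F i z @[z --> x] --> F i x.
  move=> s0; apply: cvgM; first exact: cut_c.
  by apply: cvgV; [rewrite gt_eqF|exact: sigma_c].
have sigma_near x : A x -> \forall x' \near x, 0 < sigma x'.
  by move=> Ax; apply: (cvgr_gt _ (sigma_c x)); exact: sigmaA.
have cptXX : compact [set: X * X] by rewrite -setXTT; exact: compact_setX.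
(* Besides the base point u, the parameter contains a bound e tending to eps from below, since one e
   < eps has to serve all pairs. *)
pose P (ue : Y * R) (z : X * X) := pi z.1 = ue.1 -> pi z.2 = ue.1 ->
  0 < sigma z.1 /\ (F^~ z.1 =1 F^~ z.2 -> d z.1 z.2 <= ue.2).
have nearP (z : X * X) : [set: X * X] z -> \forall z' \near z &
    ue \near filter_prod (nbhs y) (at_left eps), P ue z'.
  move=> _.
  (* A component off the fiber of y stays off nearby fibers, which makes P vacuous. *)
  have skip (pr : X * X -> X) : pr w @[w --> z] --> pr z -> pi (pr z) != y ->
      \forall z' \near z & ue \near filter_prod (nbhs y) (at_left eps),
        pi (pr z') != ue.1.
    move=> prc /near_neq[[U V] /= [zU yV] UV].
    exists (pr @^-1` U, fst @^-1` V) => /=; last first.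
      by move=> [w ue] [/= wU ueV]; exact: (UV (_, _)).
    by split; [exact: prc|exact: cvg_fst].
  have [z1y|/eqP z1y] := pselect (pi z.1 = y); last first.
    apply: filterS (skip fst cvg_fst z1y) => -[z' ue] /= /eqP z'ue /esym ?.
    by case: z'ue.
  have [z2y|/eqP z2y] := pselect (pi z.2 = y); last first.
    apply: filterS (skip snd cvg_snd z2y) => -[z' ue] /= /eqP z'ue _ /esym ?.
    by case: z'ue.
  have sz : \forall z' \near z, 0 < sigma z'.1.
    exact: (cvg_fst (sigma_near _ z1y)).
  (* Over y, either F identifies the two points and their distance stays below the midpoint of e and
     eps, or some coordinate separates them and continues to do so nearby. *)
  have [Fz|/existsNP[i Fi]] := pselect (F^~ z.1 =1 F^~ z.2).
    have [e e_eps fe] := fd _ z1y.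
    have dz : d z.1 z.2 < (e + eps) / 2.
      apply: (@le_lt_trans _ _ e); last by rewrite midf_lt.
      by apply: fe => // i; rewrite -[RHS]FA// Fz FA.
    have near_e : \forall ue \near filter_prod (nbhs y) (at_left eps),
        (e + eps) / 2 < ue.2.
      exists (setT, [set r | (e + eps) / 2 < r]) => [|ue [_ //]].
      by split; [exact: filterT|apply: nbhs_left_gt; rewrite midf_lt].
    near=> z' ue; move=> /= _ _; split; first by near: z'.
    move=> _; apply: (@le_trans _ _ ((e + eps) / 2)); apply: ltW.
      by near: z'; apply: (cvgr_lt _ (@dc z)).
    by near: ue.
  have Fiz : \forall z' \near z, F i z'.1 - F i z'.2 != 0.
    apply: (@cvgr_neq0 _ R^o _ (nbhs z) _ (fun w => F i w.1 - F i w.2)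
      (F i z.1 - F i z.2)); last by rewrite subr_eq0; exact/eqP.
    by apply: cvgB; [apply: (cvg_comp _ _ cvg_fst)|apply: (cvg_comp _ _ cvg_snd)];
      apply: F_c; exact: sigmaA.
  near=> z' ue; move=> /= _ _; split; first by near: z'.
  move=> Fz'; have /eqP[] : F i z'.1 - F i z'.2 != 0 by near: z'.
  by rewrite Fz' subrr.
have /compact_near_coveringP/(_ _ _ P _ nearP) := cptXX.
move=> [[U E] /= [yU epsE] UE].
apply: filterS yU => u Uu.
have [e [Ee e_eps]] : exists e, E e /\ e < eps.
  apply: (@filter_ex _ (at_left eps)); apply: filterI => //.
  exact: nbhs_left_lt.
have {UE}Pue z : P (u, e) z by apply: (UE (u, e)).
exists k, F; split.
- move=> i; apply/subspace_continuousP => x xu.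
  apply: cvg_within_filter; apply: F_c.
  (* The diagonal pair gives positivity of [sigma] at x. *)
  by have [] := Pue (x, x) xu xu.
- move=> x xu; have [s0 _] := Pue (x, x) xu xu; split.
  + by move=> i; rewrite divr_ge0 ?cutoff_ge0// ltW.
  + by rewrite -mulr_suml divff// gt_eqF.
  + apply: (leq_trans _ (@card_cutoff R k n (g^~ x) (g1 ^~ x))).
    apply/subset_leq_card/fintype.subsetP => i; rewrite !inE.
    by apply: contraNneq => c0; rewrite /F /retract c0 mul0r.
- move=> x xu; exists e => // x1 x2 x1u x2u Fx1 Fx2.
  by have [_] := Pue (x1, x2) x1u x2u; apply => i /=; rewrite Fx1 Fx2.
Unshelve. all: by end_near. Qed.

End FiberNeighbourhood.

(** * Continuity and splitting of the orbit metrics *)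

Section OrbitMetric.
Context {R : realType} {X : metricType R}.
Variable T : X -> X.

Lemma mdist_continuous : continuous (fun z : X * X => mdist z.1 z.2 : R).
Proof.
move=> -[a b]; apply/cvgrPdist_lt => e e0 /=.
have e20 : 0 < e / 2 by rewrite divr_gt0.
have da (x : X) : \forall x' \near x, mdist x x' < e / 2.
  by have := nbhsx_ballx x _ e20; rewrite ballEmdist.
near=> z; have za : mdist a z.1 < e / 2 by near: z; exact: (cvg_fst (da a)).
have zb : mdist b z.2 < e / 2 by near: z; exact: (cvg_snd (da b)).
have := metric_triangle a z.1 b; have := metric_triangle z.1 z.2 b.
have := metric_triangle z.1 a z.2; have := metric_triangle a b z.2.
rewrite (metric_sym z.1 a) (metric_sym z.2 b) ltr_norml; lra.
Unshelve. all: by end_near. Qed.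

Lemma mdistN_continuous N : continuous T ->
  continuous (fun z : X * X => mdistN T N z.1 z.2).
Proof.
move=> Tc z; apply: cvg_big => [|n _]; first exact: max_pair_continuous.
have Tnc : continuous (iter n T).
  by elim: (val n) => [|m IH] x //=; apply: continuous_comp; [exact: IH|exact: Tc].
apply: (cvg_comp2 _ _ (@mdist_continuous (_, _))).
  by apply: (cvg_comp fst (iter n T)); [exact: cvg_fst|exact: Tnc].
by apply: (cvg_comp snd (iter n T)); [exact: cvg_snd|exact: Tnc].
Qed.

Lemma mdistN_le N M x y : (N <= M)%N -> mdistN T N x y <= mdistN T M x y.
Proof.
move=> NM; apply: bigmax_le => [|n _]; first exact: bigmax_ge_id.
exact: (@le_bigmax_cond _ _ _ 0 (widen_ord NM n) xpredT
  (fun n : 'I_M => mdist (iter n T x) (iter n T y))).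
Qed.

Lemma mdistN_add N M x y : mdistN T (N + M) x y <=
  Num.max (mdistN T N x y) (mdistN T M (iter N T x) (iter N T y)).
Proof.
apply: bigmax_le => [|n _]; first by rewrite le_max bigmax_ge_id.
rewrite le_max; have [nN|Nn] := ltnP n N.
  by rewrite (@le_bigmax_cond _ _ _ 0 (Ordinal nN) xpredT
    (fun n : 'I_N => mdist (iter n T x) (iter n T y))).
have nM : (n - N < M)%N by rewrite ltn_subLR.
apply/orP; right; rewrite -{1 2}(subnK Nn) !iterD.
exact: (@le_bigmax_cond _ _ _ 0 (Ordinal nM) xpredT
  (fun n : 'I_M => mdist (iter n T (iter N T x)) (iter n T (iter N T y)))).
Qed.

End OrbitMetric.

(** * Uniform width bounds by cutting orbits into blocks *)

Section OrbitCovering.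
Context {R : realType} {X Y : metricType R}.
Variables (T : X -> X) (S : Y -> Y) (pi : X -> Y).
Hypotheses (cptX : compact [set: X]) (Tc : continuous T)
  (cptY : compact [set: Y]) (pic : continuous pi) (piT : pi \o T = S \o pi).

Lemma pi_iter n x : pi (iter n T x) = iter n S (pi x).
Proof. by elim: n => //= n <-; exact: (congr1 (@^~ _) piT). Qed.

Let narrow eps N y n := has_narrow_map (mdistN T N) (pi @^-1` [set y]) eps n.

(** [iter N T] carries the fiber of y into that of [iter N S y], so the second block is measured
    over the later point of the orbit. *)
Lemma narrow_fiber_add eps N M y n m :
  narrow eps N y n -> narrow eps M (iter N S y) m -> narrow eps (N + M) y (n + m).
Proof.
apply: (narrow_map_prod (h := iter N T)).
- by elim: N => [|N IH] x //=; apply: continuous_comp; [exact: IH|exact: Tc].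
- by move=> _ [x <- <-] /=; rewrite pi_iter.
- by move=> x x'; exact: mdistN_add.
Qed.

(* Compactness gives finitely many block lengths, bounded by M; the orbit of y is
   cut into blocks, each good at the point where it starts. *)
Lemma narrow_fiber_uniform eps (c : R) :
  (forall y, exists N n, [/\ (0 < N)%N, narrow eps N y n & n%:R <= c * N%:R]) ->
  exists M : nat, forall N y, exists2 n, narrow eps N y n & n%:R <= c * (N + M)%:R.
Proof.
move=> Hc.
have nearP (y : Y) : [set: Y] y -> \forall u \near y & M \near \oo,
    exists N n, [/\ (0 < N <= M)%N, narrow eps N u n & n%:R <= c * N%:R].
  move=> _; have [N [n [N0 Nn nc]]] := Hc y.
  have := near_fiber_narrow_map cptX (@metric_hausdorff _ X) (@metric_hausdorff _ Y)
    pic (mdistN_continuous (N := N) Tc) Nn.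
  move=> near_u; near=> u M => /=; exists N, n; split => //; last by near: u.
  by rewrite N0; near: M; exact: nbhs_infty_ge.
have /compact_near_coveringP/(_ _ _ _ _ nearP)[M _ /(_ M (leqnn M)) HM] := cptY.
exists M; elim/ltn_ind => N IH y.
have [N' [n [/andP[N'0 N'M] nw nc]]] := HM y I.
have c0 : 0 <= c by rewrite -(pmulr_lge0 _ (_ : 0 < N'%:R)) ?ltr0n// (le_trans _ nc).
(* A final incomplete block is charged as a full one, at cost at most c M; this is the source of the
   additive M. *)
have [NN'|N'N] := leqP N N'.
  exists n; first by apply: narrow_map_le nw => // x x'; exact: mdistN_le.
  by rewrite (le_trans nc)// ler_wpM2l// ler_nat (leq_trans N'M)// leq_addl.
have [|m mw mc] := IH (N - N')%N _ (iter N' S y).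
  by rewrite ltn_subrL N'0 (leq_trans _ N'N).
exists (n + m)%N; first by rewrite -(subnKC (ltnW N'N)); exact: narrow_fiber_add.
have -> : (N + M = N' + (N - N' + M))%N by rewrite addnA subnKC// ltnW.
by rewrite (natrD _ n) (natrD _ N') mulrDr lerD.
Unshelve. all: by end_near. Qed.

End OrbitCovering.

(** * Lower and upper limits of extended reals, limits at 0 from the right *)

Section ErealLimits.
Context {R : realType}.
Implicit Types u v : (\bar R)^nat.
Local Open Scope ereal_scope.

Lemma le_limn_esup u v : (forall n, u n <= v n) -> limn_esup u <= limn_esup v.
Proof.
move=> uv; rewrite !limn_esup_lim.
apply: lee_lim; [exact: is_cvg_esups|exact: is_cvg_esups|apply: nearW => n].
apply: ge_ereal_sup => _ [m nm <-]; apply: (le_trans (uv m)).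
by apply: ereal_sup_ubound; exists m.
Qed.

Lemma le_limn_einf u v : (forall n, u n <= v n) -> limn_einf u <= limn_einf v.
Proof.
by move=> uv; rewrite leeN2; apply: le_limn_esup => n; rewrite leeN2.
Qed.

Lemma limn_einf_cst (r : \bar R) : limn_einf (fun=> r) = r.
Proof. by have [] := cvg_limn_einf_sup (@cvg_cst _ r nat \oo _). Qed.

(** Every tail infimum is below the lower limit. The choice n = 1 will provide positive block
    lengths. *)
Lemma limn_einf_ltP u (r : \bar R) n : limn_einf u < r ->
  exists2 m, (n <= m)%N & u m < r.
Proof.
rewrite limn_einf_lim => ur.
have : einfs u n < r.
  apply: le_lt_trans ur; rewrite (cvg_lim _ (@cvg_einfs_sup _ u))//.
  by apply: ereal_sup_ubound; exists n.
by move=> /ereal_inf_lt[_ [m nm <-] um]; exists m.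
Qed.

Lemma limn_esup_einf_lim u l : limn_esup u <= l -> l <= limn_einf u -> limn u = l.
Proof.
move=> ul lu; apply/cvg_lim => //.
have lE : limn_einf u = l.
  by apply/eqP; rewrite eq_le lu andbT (le_trans (limn_einf_sup u)).
have lE' : limn_esup u = l.
  by apply/eqP; rewrite eq_le ul (le_trans lu (limn_einf_sup u)).
apply: (@squeeze_cvge _ _ _ _ (einfs u) _ (esups u)).
- apply: nearW => n; apply/andP; split.
    by apply: ereal_inf_lbound; exists n => /=.
  by apply: ereal_sup_ubound; exists n => /=.
- by rewrite -lE limn_einf_lim; exact: is_cvg_einfs.
- by rewrite -lE' limn_esup_lim; exact: is_cvg_esups.
Qed.

(** Once limits at 0 are suprema over eps, they can be exchanged with suprema over y. *)
Lemma lim_at_right0_sup (g : R -> \bar R) :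
  (forall e e', (0 < e)%R -> (e <= e')%R -> g e' <= g e) ->
  lim (g e @[e --> (0 : R)%R^'+]) = ereal_sup (g @` [set e | (0 < e)%R]).
Proof.
move=> g_anti; have -> : [set e : R | (0 < e)%R] = [set` `]0%R, +oo[ ].
  by apply/seteqP; split => e /=; rewrite in_itv /= andbT.
apply/cvg_lim => //; apply: nonincreasing_at_right_cvge => //.
by move=> e e'; rewrite in_itv /= andbT => e0 _; exact: g_anti.
Qed.

Lemma nneg_sup_ge0 (A : set \bar R) : 0 <= nneg_sup A.
Proof. by apply: ereal_sup_ubound; left. Qed.

Lemma nneg_sup_ubound (A : set \bar R) x : A x -> x <= nneg_sup A.
Proof. by move=> Ax; apply: ereal_sup_ubound; right. Qed.

Lemma ge_nneg_sup (A : set \bar R) b : 0 <= b -> (forall x, A x -> x <= b) ->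
  nneg_sup A <= b.
Proof. by move=> b0 Ab; apply: ge_ereal_sup => x [->//|/Ab]. Qed.

End ErealLimits.

(** * Monotonicity of the width in eps *)

Section WidimMonotone.
Context {R : realType} {X : topologicalType}.
Implicit Types (d : X -> X -> R) (A : set X).

Lemma Widim_anti d A eps eps' : eps <= eps' -> (Widim d A eps' <= Widim d A eps)%E.
Proof.
move=> ee; apply: ereal_inf_le_tmp => _ [n [k [K [f [Kn [fc fK fd]]]]] <-].
exists n => //; exists k, K, f; split => //; split => // p Kp.
by apply: (lt_le_trans (fd p Kp)); rewrite lee_fin.
Qed.

End WidimMonotone.

(** * Comparison of the three mean dimensions *)

Section MeanDimension.
Context {R : realType} {X Y : metricType R}.
Variables (T : X -> X) (S : Y -> Y) (pi : X -> Y).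
Hypotheses (cptX : compact [set: X]) (Tc : continuous T)
  (cptY : compact [set: Y]) (pic : continuous pi) (pi_surj : range pi = setT)
  (piT : pi \o T = S \o pi).
Local Open Scope ereal_scope.

Let width eps y N := Widim (mdistN T N) (pi @^-1` [set y]) eps.
Let growth eps y N := width eps y N * (N%:R^-1)%:E.
Let sup_growth eps N :=
  nneg_sup [set Widim (mdistN T N) (pi @^-1` [set y]) eps | y in [set: Y]] *
  (N%:R^-1)%:E.

Let growth_le_sup eps y N : growth eps y N <= sup_growth eps N.
Proof. by apply: lee_wpmul2r; rewrite ?lee_fin//; apply: nneg_sup_ubound; exists y. Qed.

Let sup_growth_ge0 eps N : 0 <= sup_growth eps N.
Proof. by apply: mule_ge0; [exact: nneg_sup_ge0|rewrite lee_fin]. Qed.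

Let growth_anti eps eps' y N : (eps <= eps')%R -> growth eps' y N <= growth eps y N.
Proof. by move=> ee; apply: lee_wpmul2r; rewrite ?lee_fin//; exact: Widim_anti. Qed.

(** The block bound c (N + M) holds for all fibers at once, and c (N + M) / N tends to c. *)
Lemma limsup_sup_growth eps (c : R) : (0 < eps)%R -> (0 <= c)%R ->
  (forall y, limn_einf (growth eps y) < c%:E) ->
  limn_esup (sup_growth eps) <= c%:E.
Proof.
move=> eps0 c0 Hc.
have [M HM] : exists M : nat, forall N y, exists2 n,
    has_narrow_map (mdistN T N) (pi @^-1` [set y]) eps n & (n%:R <= c * (N + M)%:R)%R.
  apply: (narrow_fiber_uniform cptX Tc cptY pic piT) => y.
  have [N N0 gN] := limn_einf_ltP 1 (Hc y).
  have Nr0 : (0 < N%:R :> R)%R by rewrite ltr0n.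
  have /Widim_lt[n nw nc] : width eps y N < (c * N%:R)%:E.
    by rewrite EFinM -lte_pdivrMr.
  by exists N, n; split => //; rewrite -lee_fin ltW.
have bound N : (0 < N)%N -> sup_growth eps N <= (c + c * M%:R * N%:R^-1)%:E.
  move=> N0; have Nr0 : (0 < N%:R :> R)%R by rewrite ltr0n.
  have cNM : ((c + c * M%:R * N%:R^-1) * N%:R = c * (N + M)%:R)%R.
    by rewrite natrD mulrDl mulfVK ?gt_eqF// -mulrDr.
  rewrite /sup_growth lee_pdivrMr// -EFinM cNM.
  apply: ge_nneg_sup; first by rewrite lee_fin mulr_ge0.
  move=> _ [y _ <-]; have [n nw nc] := HM N y.
  apply: (@le_trans _ _ n%:R%:E); last by rewrite lee_fin.
  (* Surjectivity makes the fiber nonempty, as [Widim_le] requires. *)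
  apply: Widim_le => //; have : range pi y by rewrite pi_surj.
  by case=> x _ <-; exists x.
have lim_bound : (c + c * M%:R * N%:R^-1)%R%:E @[N --> \oo] --> c%:E.
  apply: cvg_EFin; first exact: nearW.
  rewrite -[X in _ --> X]addr0; apply: cvgD; first exact: cvg_cst.
  rewrite -[X in _ --> X](mulr0 (c * M%:R)%R); apply: cvgM; first exact: cvg_cst.
  by rewrite -cvg_shiftS; exact: cvg_harmonic.
have [_ <-] := cvg_limn_einf_sup lim_bound; apply: le_limn_esup => -[|N].
  (* At N = 0 the inverse is 0 by convention, and the claim becomes 0 <= c. *)
  by rewrite /sup_growth invr0 mulr0 addr0 mule0 lee_fin.
exact: bound.
Qed.

Lemma limn_esup_sup_growth eps : (0 < eps)%R -> limn_esup (sup_growth eps) <=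
  nneg_sup [set limn_einf (growth eps y) | y in [set: Y]].
Proof.
move=> eps0; set L := nneg_sup _.
have L0 : 0 <= L by exact: nneg_sup_ge0.
have : forall y, limn_einf (growth eps y) <= L.
  by move=> y; apply: nneg_sup_ubound; exists y.
case: L L0 => [r r0 Lr|_ _|//]; last exact: leey.
(* The slack e turns the bound L on the lower limits into the strict bound needed, with c = L +
   e. *)
apply/lee_addgt0Pr => e e0; rewrite -EFinD.
apply: limsup_sup_growth => // [|y].
  by rewrite addr_ge0 ?(ltW e0)// -lee_fin.
by apply: (le_lt_trans (Lr y)); rewrite lte_fin ltrDl.
Qed.

(** The right-hand side is at least the upper limit of [sup_growth eps] and, fiber by fiber, at most
    its lower limit; hence the sequence converges. *)
Lemma lim_sup_growth eps : (0 < eps)%R ->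
  limn (sup_growth eps) =
  nneg_sup [set limn_einf (growth eps y) | y in [set: Y]].
Proof.
move=> eps0; apply: limn_esup_einf_lim; first exact: limn_esup_sup_growth.
apply: ge_nneg_sup => [|_ [y _ <-]]; last by apply: le_limn_einf => N.
by rewrite -(limn_einf_cst 0); exact: le_limn_einf.
Qed.

Let lower_mdim_sup y : lower_mdim T (pi @^-1` [set y]) =
  ereal_sup [set limn_einf (growth eps y) | eps in [set e | (0 < e)%R]].
Proof.
apply: (lim_at_right0_sup (g := fun eps => limn_einf (growth eps y))).
by move=> e e' _ ee; apply: le_limn_einf => N; exact: growth_anti.
Qed.

Let upper_mdim_sup y : upper_mdim T (pi @^-1` [set y]) =
  ereal_sup [set limn_esup (growth eps y) | eps in [set e | (0 < e)%R]].
Proof.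
apply: (lim_at_right0_sup (g := fun eps => limn_esup (growth eps y))).
by move=> e e' _ ee; apply: le_limn_esup => N; exact: growth_anti.
Qed.

(** Monotonicity in eps is checked on the lower limits supplied by [lim_sup_growth], where it is
    termwise. *)
Let relative_mdim_sup : relative_mdim T pi =
  ereal_sup [set limn (sup_growth eps) | eps in [set e | (0 < e)%R]].
Proof.
apply: (lim_at_right0_sup (g := fun eps => limn (sup_growth eps))).
move=> e e' e0 ee; rewrite (lim_sup_growth e0) (lim_sup_growth (lt_le_trans e0 ee)).
apply: ge_nneg_sup => [|_ [y _ <-]]; first exact: nneg_sup_ge0.
apply: (@le_trans _ _ (limn_einf (growth e y))).
  by apply: le_limn_einf => N; exact: growth_anti.
by apply: nneg_sup_ubound; exists y.
Qed.

Lemma relative_mdim_le_lower : relative_mdim T pi <=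
  nneg_sup [set lower_mdim T (pi @^-1` [set y]) | y in [set: Y]].
Proof.
rewrite relative_mdim_sup; apply: ge_ereal_sup => _ [eps /= eps0 <-].
rewrite lim_sup_growth//; apply: ge_nneg_sup => [|_ [y _ <-]].
  exact: nneg_sup_ge0.
apply: (@le_trans _ _ (lower_mdim T (pi @^-1` [set y]))).
  by rewrite lower_mdim_sup; apply: ereal_sup_ubound; exists eps.
by apply: nneg_sup_ubound; exists y.
Qed.

Lemma lower_mdim_le_upper :
  nneg_sup [set lower_mdim T (pi @^-1` [set y]) | y in [set: Y]] <=
  nneg_sup [set upper_mdim T (pi @^-1` [set y]) | y in [set: Y]].
Proof.
apply: ge_nneg_sup => [|_ [y _ <-]]; first exact: nneg_sup_ge0.
apply: (@le_trans _ _ (upper_mdim T (pi @^-1` [set y]))); last first.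
  by apply: nneg_sup_ubound; exists y.
rewrite lower_mdim_sup upper_mdim_sup; apply: ge_ereal_sup => _ [eps eps0 <-].
apply: (le_trans (limn_einf_sup _)).
by apply: ereal_sup_ubound; exists eps.
Qed.

Lemma upper_mdim_le_relative :
  nneg_sup [set upper_mdim T (pi @^-1` [set y]) | y in [set: Y]] <=
  relative_mdim T pi.
Proof.
have lim_le eps : (0 < eps)%R -> limn (sup_growth eps) <= relative_mdim T pi.
  by move=> eps0; rewrite relative_mdim_sup; apply: ereal_sup_ubound; exists eps.
apply: ge_nneg_sup => [|_ [y _ <-]].
  (* Nonnegativity of the relative mean dimension can be read off at any scale, here eps = 1. *)
  apply: (le_trans _ (lim_le 1%R ltr01)).
  by rewrite lim_sup_growth//; exact: nneg_sup_ge0.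
rewrite upper_mdim_sup; apply: ge_ereal_sup => _ [eps /= eps0 <-].
apply: (le_trans _ (lim_le _ eps0)).
apply: (@le_trans _ _ (limn_esup (sup_growth eps))); first exact: le_limn_esup.
by rewrite lim_sup_growth//; exact: limn_esup_sup_growth.
Qed.

End MeanDimension.

Theorem proposition1p1 (R : realType) (X Y : metricType R)
    (T : X -> X) (S : Y -> Y) (pi : X -> Y)
    (hX : dynamical_system T) (hY : dynamical_system S)
    (hpi : factor_map T S pi) :
  relative_mdim T pi =
    nneg_sup [set upper_mdim T (pi @^-1` [set y]) | y in [set: Y]] /\
  nneg_sup [set upper_mdim T (pi @^-1` [set y]) | y in [set: Y]] =
    nneg_sup [set lower_mdim T (pi @^-1` [set y]) | y in [set: Y]].
Proof.
have [cptX [Tc _]] := hX; have [cptY _] := hY; have [pic pi_surj piT] := hpi.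
have rel_lower := relative_mdim_le_lower cptX Tc cptY pic pi_surj piT.
have upper_rel := upper_mdim_le_relative cptX Tc cptY pic pi_surj piT.
have lower_upper := lower_mdim_le_upper T pi.
split; apply/eqP; rewrite eq_le.
  by rewrite upper_rel andbT (le_trans rel_lower).
by rewrite lower_upper andbT (le_trans upper_rel).
Qed.
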